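(* Any two metric bases for a (nonzero) graded ideal $I\subseteq\mathbb C[z_1,\dots,z_d]$ are equivalent.
   Context: Let $d\ge1$, $A=\mathbb C[z_1,\dots,z_d]$, with the inner product norm $\|\cdot\|$ on $A$ for which monomials are mutually orthogonal and $\|z^\alpha\|^2=\alpha!/|\alpha|!$ (the norm of the symmetric Fock space $H^2(\mathbb C^d)$). An ideal is graded if it is spanned by its homogeneous polynomials. A generator of a graded ideal $I$ is a (finite or infinite) linearly independent set $\Phi$ of homogeneous polynomials in $I$ such that every $g\in I$ is a finite sum $g=f_1\phi_1+\dots+f_r\phi_r$ with $f_k\in A$, $\phi_k\in\Phi$. It is contractive if $\|f_1\phi_1+\dots+f_r\phi_r\|^2\le\|f_1\|^2+\dots+\|f_r\|^2$ for all distinct $\phi_1,\dots,\phi_r\in\Phi$ and all $f_1,\dots,f_r\in A$. A metric basis for a nonzero graded ideal $I$ is a contractive generator $\Phi$ such that every polynomial $g\in I$ of degree $n$ has a representation $g=f_1\phi_1+\dots+f_r\phi_r$ with $\phi_1,\dots,\phi_r$ distinct elements of $\Phi$, $f_k\in A$, satisfying (1) $\deg\phi_k+\deg f_k\le n$ for $k=1,\dots,r$, and (2) $\|g\|^2=\|f_1\|^2+\dots+\|f_r\|^2$. Two finite linearly independent sets $\{\xi_1,\dots,\xi_m\}$, $\{\eta_1,\dots,\eta_n\}$ of vectors are equivalent if $m=n$ and there is a unitary matrix $(u_{ij})\in M_n(\mathbb C)$ with $\eta_i=\sum_{j=1}^nu_{ij}\xi_j$ for $i=1,\dots,n$ (two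 empty sets are equivalent). Two linearly independent sets $\Phi,\Psi$ of homogeneous polynomials are equivalent if for every $n=0,1,2,\dots$ the sets $\Phi_n$ and $\Psi_n$ of their elements of degree $n$ are equivalent. *)

(* Defs.v *)
(* The complex numbers are R[i] for R : realType. *)
From HB Require Import structures.
From mathcomp Require Import all_boot all_order all_algebra.
From mathcomp Require Import complex mpoly.
From mathcomp Require Import classical_sets reals spectral.

Set Implicit Arguments.
Unset Strict Implicit.
Unset Printing Implicit Defensive.

Import Order.TTheory GRing.Theory Num.Theory.

Local Open Scope ring_scope.
Local Open Scope classical_set_scope.

Section LinearAlgebra.
Variables (C : numClosedFieldType) (V : lmodType C).
Implicit Types X Y : set V.

(* Injectivity of v: the vectors are distinct elements of X. *)
Definition lin_independent X : Prop :=
  forall (r : nat) (v : 'I_r -> V), injective v -> (forall k, X (v k)) ->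
  forall c : 'I_r -> C, \sum_k c k *: v k = 0 -> forall k, c k = 0.

Definition enumerates n (v : 'I_n -> V) X : Prop := injective v /\ range v = X.

(* The choice of enumerations does not matter, since permutation matrices are
   unitary. *)
Definition equivalent_fin X Y : Prop :=
  exists (n : nat) (xi eta : 'I_n -> V),
    [/\ enumerates xi X, enumerates eta Y
      & exists2 u : 'M[C]_n, u \is unitarymx
          & forall i, eta i = \sum_j u i j *: xi j].

End LinearAlgebra.

Section MetricBasis.
Variables (R : realType) (d : nat).
Notation C := R[i].
Notation A := {mpoly C[d]}.
Implicit Types (p q g : A) (I Phi Psi : set A).

(* msize p is 1 + deg p for p != 0 and msize 0 = 0, so deg 0 = 0 here. *)
Definition deg p : nat := (msize p).-1.

(* The inner product of the symmetric Fock space; `|m|! = (mdeg m)`! *)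
Definition fock_dot p q : C :=
  \sum_(m <- msupp p)
     p@_m * (q@_m)^* * ((\prod_(i < d) (m i)`!)%N%:R / ((mdeg m)`!)%:R).

(* Complex-valued, but real and nonnegative; the order of R[i] restricts to the
   usual order on the reals. *)
Definition fock_norm p : C := sqrtC (fock_dot p p).

Definition homogeneous p : Prop := exists n : nat, p \is n.-homog.

(* Not the library's idealr_closed, which excludes the unit ideal. *)
Definition is_ideal I : Prop :=
  [/\ I 0, forall p q, I p -> I q -> I (p + q)
    & forall f p, I p -> I (f * p)].

Definition graded I : Prop :=
  forall g, I g -> exists (r : nat) (c : 'I_r -> C) (h : 'I_r -> A),
    (forall k, I (h k) /\ homogeneous (h k)) /\ g = \sum_k c k *: h k.

Definition is_generator I Phi : Prop :=
  [/\ forall p, Phi p -> I p /\ homogeneous p,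
      lin_independent Phi
    & forall g, I g -> exists (r : nat) (f phi : 'I_r -> A),
        (forall k, Phi (phi k)) /\ g = \sum_k f k * phi k].

Definition contractive Phi : Prop :=
  forall (r : nat) (phi : 'I_r -> A), injective phi -> (forall k, Phi (phi k)) ->
  forall f : 'I_r -> A,
    fock_norm (\sum_k f k * phi k) ^+ 2 <= \sum_k fock_norm (f k) ^+ 2.

(* The proviso f k != 0 in the degree bound is the convention deg 0 = -oo. *)
Definition is_metric_basis I Phi : Prop :=
  [/\ is_generator I Phi,
      contractive Phi
    & forall g, I g -> exists (r : nat) (f phi : 'I_r -> A),
        [/\ injective phi, forall k, Phi (phi k),
            g = \sum_k f k * phi k,
            forall k, f k != 0 -> (deg (phi k) + deg (f k) <= deg g)%N
          & fock_norm g ^+ 2 = \sum_k fock_norm (f k) ^+ 2]].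

Definition equivalent_sets Phi Psi : Prop :=
  forall n : nat,
    equivalent_fin [set p | Phi p /\ deg p = n] [set p | Psi p /\ deg p = n].

End MetricBasis.

(* Main.v *)
(* For phi in a metric basis Phi of I write phi^* for the adjoint of
   multiplication by phi. Perturbing one coefficient of an isometric
   representation g = sum f_k phi_k cannot beat contractivity, so the first
   variation vanishes, which forces f_k = phi_k^* g; hence
   g = sum_(phi in Phi) phi (phi^* g) for every g in I. For g homogeneous of
   degree n only elements of degree at most n contribute, and those of degree n
   contribute <g, phi> phi. The contribution of each layer Phi_k is unchanged
   under unitary equivalence, so by strong induction
   sum_(phi in Phi_n) <g, phi> phi = sum_(psi in Psi_n) <g, psi> psi on I_n;
   evaluating this at the dual bases of Phi_n and Psi_n yields the unitary
   matrix. *)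
Require Import Defs.
From HB Require Import structures.
From mathcomp Require Import all_boot all_order all_algebra.
From mathcomp Require Import complex ssrcomplements mpoly.
From mathcomp Require Import boolp classical_sets reals spectral ring.

Set Implicit Arguments.
Unset Strict Implicit.
Unset Printing Implicit Defensive.

Import Order.TTheory GRing.Theory Num.Theory.

(** * A variational inequality and finiteness of sets *)

Section Preliminaries.
Local Open Scope ring_scope.

(** At [t = e * z^*] with [e > 0] the left side is [2 e |z|^2] and the right side [e^2 |z|^2 c], so
    [z != 0] would force [2 <= e * c] for all [e > 0]. Then [e = 1] shows [c > 0], and [e = c^-1]
    gives [2 <= 1]. *)
Lemma first_variation_eq0 (C : numClosedFieldType) (z c : C) :
  (forall t : C, t * z + (t * z)^* <= t * t^* * c) -> z = 0.
Proof.
move=> h; apply/eqP; apply/negPn/negP => z0.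
have zz0 : 0 < z * z^* by rewrite mul_conjC_gt0.
have h1 (e : C) : 0 < e -> 2%:R <= e * c.
  move=> e0; have := h (e * z^*).
  have er : e^* = e by apply/conj_Creal/gtr0_real.
  rewrite !rmorphM /= !conjCK er.
  have -> : e * z^* * z + e * z * z^* = 2%:R * (e * (z * z^*)) by ring.
  have -> : e * z^* * (e * z) * c = e * c * (e * (z * z^*)) by ring.
  by rewrite ler_pM2r // mulr_gt0.
have c0 : 0 < c.
  by have := h1 1 ltr01; rewrite mul1r; apply: lt_le_trans; rewrite ltr0n.
have := h1 c^-1; rewrite invr_gt0 => /(_ c0); rewrite mulVf ?gt_eqF //.
by rewrite -[1]/1%:R ler_nat.
Qed.

Lemma eq_big_nonzero (T : eqType) (V : nmodType) (s t : seq T) (F : T -> V) :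
  uniq s -> uniq t ->
  (forall x, x \in s -> F x != 0 -> x \in t) ->
  (forall x, x \in t -> F x != 0 -> x \in s) ->
  \sum_(x <- s) F x = \sum_(x <- t) F x.
Proof.
move=> us ut st ts.
have nz (r : seq T) :
    \sum_(x <- r) F x = \sum_(x <- [seq x <- r | F x != 0]) F x.
  rewrite big_filter [RHS]big_mkcond; apply: eq_bigr => x _.
  by case: eqP.
rewrite nz [RHS]nz; apply/perm_big/uniq_perm; rewrite ?filter_uniq // => x.
rewrite !mem_filter; have [//|Fx] := eqVneq (F x) 0.
by apply/idP/idP => [/st|/ts] /(_ Fx).
Qed.

(** Otherwise every duplicate-free list in [X] could be extended, up to length [N.+1]. *)
Lemma finite_enum (T : eqType) (X : set T) (N : nat) :
  (forall s : seq T, uniq s -> (forall x, x \in s -> X x) -> (size s <= N)%N) ->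
  exists s, uniq s /\ forall x, x \in s <-> X x.
Proof.
move=> bnd; apply: contrapT => nex.
suff: exists s : seq T,
    [/\ uniq s, forall x, x \in s -> X x & size s = N.+1].
  by case=> s [us /(bnd _ us) /[swap] ->]; rewrite ltnn.
elim: (N.+1) => [|k [s [us sX sk]]]; first by exists [::].
have [x [Xx xs]] : exists x, X x /\ x \notin s.
  apply: contrapT => nx; apply: nex; exists s; split=> // x; split=> [/sX//|Xx].
  by apply/negPn/negP => xs; apply: nx; exists x.
exists (x :: s); rewrite /= us xs sk; split=> // y.
by rewrite inE => /orP[/eqP->//|/sX].
Qed.

End Preliminaries.

(** * The Fock inner product and adjoints of multiplication operators *)

Section FockSpace.
Local Open Scope ring_scope.
Variables (R : realType) (d : nat).
Notation C := R[i].
Notation A := {mpoly C[d]}.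
Implicit Types (p q g f phi : A) (c : C) (m : 'X_{1..d}).

(** The squared norm of the monomial ['X_[m]]. *)
Definition fock_weight m : C :=
  (\prod_(i < d) (m i)`!)%N%:R / ((mdeg m)`!)%:R.

Lemma fock_weight_gt0 m : 0 < fock_weight m.
Proof.
by rewrite divr_gt0 ?ltr0n ?fact_gt0 ?prodn_gt0 // => i; rewrite fact_gt0.
Qed.

Lemma fock_weight_conj m : (fock_weight m)^* = fock_weight m.
Proof. by apply/conj_Creal/gtr0_real/fock_weight_gt0. Qed.

Lemma fock_weight0 : fock_weight 0%MM = 1.
Proof.
by rewrite /fock_weight mdeg0 big1 ?divr1 // => i _; rewrite mnm0E.
Qed.

(** A common finite index type allows sums for different polynomials to be compared termwise. *)
Lemma fock_dot_bounded (K : nat) p q : (msize p <= K)%N ->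
  fock_dot p q = \sum_(m : 'X_{1..d < K}) p@_m * (q@_m)^* * fock_weight m.
Proof.
move=> pK; rewrite /fock_dot (big_mksub 'X_{1..d < K}) //=; first last.
- by move=> m /msize_mdeg_lt /leq_trans; apply.
- by rewrite msupp_uniq.
by rewrite big_rmcond //= => m /memN_msupp_eq0 ->; rewrite !mul0r.
Qed.

Lemma fock_dotDl p q g : fock_dot (p + q) g = fock_dot p g + fock_dot q g.
Proof.
pose K := maxn (msize (p + q)) (maxn (msize p) (msize q)).
rewrite !(@fock_dot_bounded K) ?leq_max ?leqnn ?orbT // -big_split.
by apply: eq_bigr => m _; rewrite mcoeffD !mulrDl.
Qed.

Lemma fock_dotZl c p g : fock_dot (c *: p) g = c * fock_dot p g.
Proof.
pose K := maxn (msize (c *: p)) (msize p).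
rewrite !(@fock_dot_bounded K) ?leq_max ?leqnn ?orbT // mulr_sumr.
by apply: eq_bigr => m _; rewrite mcoeffZ !mulrA.
Qed.

Lemma fock_dotC p q : fock_dot q p = (fock_dot p q)^*.
Proof.
pose K := maxn (msize p) (msize q).
rewrite !(@fock_dot_bounded K) ?leq_max ?leqnn ?orbT // rmorph_sum.
apply: eq_bigr => m _.
rewrite [in RHS]rmorphM /= fock_weight_conj rmorphM /= conjCK.
by rewrite [q@_m * _]mulrC.
Qed.

Lemma fock_dotDr p q g : fock_dot g (p + q) = fock_dot g p + fock_dot g q.
Proof. by rewrite fock_dotC fock_dotDl rmorphD /= -!fock_dotC. Qed.

Lemma fock_dotZr c p g : fock_dot g (c *: p) = c^* * fock_dot g p.
Proof. by rewrite fock_dotC fock_dotZl rmorphM /= -!fock_dotC. Qed.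

Lemma fock_dot0l g : fock_dot 0 g = 0.
Proof. by rewrite -(scale0r 0) fock_dotZl mul0r. Qed.

Lemma fock_dot0r g : fock_dot g 0 = 0.
Proof. by rewrite fock_dotC fock_dot0l conjC0. Qed.

Lemma fock_dot_suml (J : Type) (s : seq J) (P : pred J) (F : J -> A) g :
  fock_dot (\sum_(j <- s | P j) F j) g = \sum_(j <- s | P j) fock_dot (F j) g.
Proof.
by apply: (big_morph (fun p => fock_dot p g)) => [p q|];
  rewrite ?fock_dotDl ?fock_dot0l.
Qed.

Lemma fock_dot_sumr (J : Type) (s : seq J) (P : pred J) (F : J -> A) g :
  fock_dot g (\sum_(j <- s | P j) F j) = \sum_(j <- s | P j) fock_dot g (F j).
Proof.
by apply: (big_morph (fock_dot g)) => [p q|];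
  rewrite ?fock_dotDr ?fock_dot0r.
Qed.

Lemma fock_dot_ge0 p : 0 <= fock_dot p p.
Proof.
apply: sumr_ge0 => m _; apply: mulr_ge0; first exact: mul_conjC_ge0.
exact/ltW/fock_weight_gt0.
Qed.

Lemma fock_dot_eq0 p : fock_dot p p = 0 -> p = 0.
Proof.
move=> /eqP; rewrite psumr_eq0 => [/allP p0|m _]; last first.
  by apply: mulr_ge0; [exact: mul_conjC_ge0|exact/ltW/fock_weight_gt0].
apply/mpolyP => m; rewrite mcoeff0.
have [/p0|/memN_msupp_eq0//] := boolP (m \in msupp p).
by rewrite /= mulf_eq0 (gt_eqF (fock_weight_gt0 m)) orbF mulf_eq0 conjC_eq0
  orbb => /eqP.
Qed.

Lemma fock_normK p : fock_norm p ^+ 2 = fock_dot p p.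
Proof. by rewrite /fock_norm sqrtCK. Qed.

Lemma fock_dotX f m : fock_dot f 'X_[m] = f@_m * fock_weight m.
Proof.
rewrite fock_dotC /fock_dot msuppX big_seq1 mcoeffX eqxx mul1r.
by rewrite rmorphM /= fock_weight_conj conjCK.
Qed.

Lemma fock_dot_homog n k p q : p \is n.-homog -> q \is k.-homog ->
  n != k -> fock_dot p q = 0.
Proof.
move=> hp hq nk; rewrite /fock_dot big_seq big1 // => m mp.
have /= mn := dhomog_mf hp mp.
by rewrite (dhomog_nemf_coeff hq) ?conjC0 ?mulr0 ?mul0r //= mn.
Qed.

(* The adjoint of multiplication by phi; the bound is harmless since the
   dropped coefficients vanish. *)
Definition fock_adj phi g : A :=
  \sum_(m : 'X_{1..d < msize g})
     (fock_dot g (phi * 'X_[m]) / fock_weight m) *: 'X_[m].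

Lemma mcoeff_fock_adj phi g m :
  (fock_adj phi g)@_m = fock_dot g (phi * 'X_[m]) / fock_weight m.
Proof.
rewrite /fock_adj.
have [mg|gm] := ltnP (mdeg m) (msize g).
  by rewrite (mcoeff_mpoly
    (fun m => fock_dot g (phi * 'X_[m]) / fock_weight m)).
(* Monomials of [phi * 'X_[m]] have degree at least [mdeg m], those of [g] smaller degree. *)
have -> : fock_dot g (phi * 'X_[m]) = 0.
  rewrite /fock_dot big_seq big1 // => m' m'g.
  rewrite [X in X^*]memN_msupp_eq0 ?conjC0 ?mulr0 ?mul0r //.
  apply/negP; rewrite (perm_mem (msuppMX _ _)) => /mapP[m1 _ m'E].
  have := leq_trans (msize_mdeg_lt m'g) gm.
  by rewrite m'E mdegD ltnNge leq_addr.
rewrite mul0r raddf_sum big1 // => i _; rewrite /= mcoeffZ mcoeffX.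
case: eqP => [im|]; last by rewrite mulr0.
by have := bmdeg i; rewrite im ltnNge gm.
Qed.

(** Taking for [a] the monomials recovers every coefficient of [f]. *)
Lemma fock_adjP phi g f :
  (forall a, fock_dot f a = fock_dot g (phi * a)) -> f = fock_adj phi g.
Proof.
move=> fE; apply/mpolyP => m; rewrite mcoeff_fock_adj -fE fock_dotX mulfK //.
by rewrite gt_eqF ?fock_weight_gt0.
Qed.

Lemma fock_adj_sum n (u : 'I_n -> C) (xi : 'I_n -> A) g :
  fock_adj (\sum_i u i *: xi i) g = \sum_i (u i)^* *: fock_adj (xi i) g.
Proof.
apply/mpolyP => m; rewrite mcoeff_fock_adj [RHS]raddf_sum /=.
rewrite [X in fock_dot g X]mulr_suml fock_dot_sumr mulr_suml.
apply: eq_bigr => i _.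
by rewrite mcoeffZ mcoeff_fock_adj -scalerAl fock_dotZr mulrA.
Qed.

Lemma fock_adj_homog_gt n k phi g : phi \is k.-homog -> g \is n.-homog ->
  (n < k)%N -> fock_adj phi g = 0.
Proof.
move=> hphi hg nk; apply/mpolyP => m; rewrite mcoeff_fock_adj mcoeff0.
have hX : ('X_[m] : A) \is (mdeg m).-homog by rewrite dhomogX.
rewrite (fock_dot_homog hg (dhomogM hphi hX)) ?mul0r //.
by rewrite ltn_eqF // ltn_addr.
Qed.

(** For [m] nonzero, [phi * 'X_[m]] has degree above [n] and is orthogonal to [g], so only the
    constant coefficient survives. *)
Lemma fock_adj_homog_eq n phi g : phi \is n.-homog -> g \is n.-homog ->
  fock_adj phi g = (fock_dot g phi)%:MP.
Proof.
move=> hphi hg; apply/mpolyP => m; rewrite mcoeff_fock_adj mcoeffC.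
have [<-|m0] := eqVneq 0%MM m.
  by rewrite fock_weight0 divr1 mpolyX0 !mulr1.
have hX : ('X_[m] : A) \is (mdeg m).-homog by rewrite dhomogX.
rewrite mulr0 (fock_dot_homog hg (dhomogM hphi hX)) ?mul0r //.
by rewrite -{1}[n]addn0 eqn_add2l eq_sym mdeg_eq0 eq_sym.
Qed.

End FockSpace.

(** * Metric bases: coefficients as adjoints, and decomposition by degree *)

Section MetricBases.
Local Open Scope ring_scope.
Variables (R : realType) (d : nat).
Notation C := R[i].
Notation A := {mpoly C[d]}.
Implicit Types (p q g f phi : A) (I Phi Psi : set A).

Lemma contractive_seq Phi (s : seq A) (F : A -> A) : contractive Phi ->
  uniq s -> (forall p, p \in s -> Phi p) ->
  fock_dot (\sum_(p <- s) F p * p) (\sum_(p <- s) F p * p)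
    <= \sum_(p <- s) fock_dot (F p) (F p).
Proof.
move=> cPhi us sPhi.
have le_N := @cPhi (size s) (fun k => s`_k) _ _ (fun k => F s`_k).
rewrite fock_normK (eq_bigr _ (fun _ _ => fock_normK _)) in le_N.
rewrite (big_nth 0) big_mkord [leRHS](big_nth 0) big_mkord; apply: le_N.
- by move=> i j /eqP; rewrite nth_uniq // => /eqP /val_inj.
- by move=> k; apply/sPhi/mem_nth.
Qed.

Lemma metric_basis_seq I Phi g : is_metric_basis I Phi -> I g ->
  exists s F, [/\ uniq s, forall p, p \in s -> Phi p,
    g = \sum_(p <- s) F p * p
    & fock_dot g g = \sum_(p <- s) fock_dot (F p) (F p)].
Proof.
move=> [_ _ rep] /rep[r [f [v [vI vPhi gE _ nE]]]].
(* As [v] is injective, each fibre has at most one index, so [F] just reindexes [f] by basis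
   elements. *)
pose F p := \sum_(k | v k == p) f k.
have FE k : F (v k) = f k.
  by rewrite /F (big_pred1 k) // => j; rewrite /= (inj_eq vI).
exists [seq v k | k <- enum 'I_r], F; split.
- by rewrite map_inj_uniq ?enum_uniq.
- by move=> p /mapP[k _ ->].
- by rewrite big_map big_enum gE; apply: eq_bigr => k _; rewrite FE.
rewrite -fock_normK nE big_map big_enum.
by apply: eq_bigr => k _; rewrite FE fock_normK.
Qed.

(* An isometric representation minimises the contractivity defect, so the first
   variation of the defect vanishes there. *)
Lemma isometric_coef_adj Phi (s : seq A) (F : A -> A) g p : contractive Phi ->
  uniq s -> (forall q, q \in s -> Phi q) -> g = \sum_(q <- s) F q * q ->
  fock_dot g g = \sum_(q <- s) fock_dot (F q) (F q) ->
  p \in s -> F p = fock_adj p g.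
Proof.
move=> cPhi us sPhi gE nE ps; apply: fock_adjP => a.
apply/esym/eqP; rewrite -subr_eq0; apply/eqP.
(* The constant is the difference of the second-order terms on the two sides of contractivity. *)
apply: (@first_variation_eq0 _ _ (fock_dot a a - fock_dot (p * a) (p * a))).
move=> t.
(* The conjugate is there because [fock_dot] is conjugate-linear on the right: [fock_dot (F p) a]
   then gets the factor [t]. *)
pose G q := if q == p then F p + t^* *: a else F q.
have GE q : q != p -> G q = F q by rewrite /G => /negbTE ->.
have := @contractive_seq Phi s G cPhi us sPhi.
have -> : \sum_(q <- s) G q * q = g + t^* *: (p * a).
  rewrite gE (bigD1_seq p) //= [in RHS](bigD1_seq p) //= {1}/G eqxx.
  rewrite (eq_bigr (fun q => F q * q)) => [|q qp]; last by rewrite GE.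
  by rewrite mulrDl addrAC -scalerAl [a * p]mulrC.
have -> : \sum_(q <- s) fock_dot (G q) (G q) = fock_dot g g +
    (t * fock_dot (F p) a + t^* * fock_dot a (F p) + t * t^* * fock_dot a a).
  rewrite nE (bigD1_seq p) //= [in RHS](bigD1_seq p) //= {1 2}/G eqxx.
  rewrite (eq_bigr (fun q => fock_dot (F q) (F q))) => [|q qp];
    last by rewrite GE.
  rewrite !(fock_dotDl, fock_dotDr, fock_dotZl, fock_dotZr) conjCK.
  by ring.
rewrite !(fock_dotDl, fock_dotDr, fock_dotZl, fock_dotZr) conjCK.
rewrite -!addrA lerD2l => le_N.
rewrite rmorphM rmorphB /= -!fock_dotC.
rewrite -subr_ge0; move: le_N; rewrite -subr_ge0; congr (_ <= _).
by ring.
Qed.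

Lemma metric_basis_adj I Phi g : is_metric_basis I Phi -> I g ->
  exists s, [/\ uniq s, forall p, p \in s -> Phi p,
    g = \sum_(p <- s) fock_adj p g * p
    & forall p, Phi p -> p \notin s -> fock_adj p g = 0].
Proof.
move=> mPhi Ig; have cPhi : contractive Phi by case: mPhi.
have [s [F [us sPhi gE nE]]] := metric_basis_seq mPhi Ig.
have FE := isometric_coef_adj cPhi us sPhi gE nE.
exists s; split=> // [|p Phip ps].
  by rewrite {1}gE big_seq [RHS]big_seq; apply: eq_bigr => p /FE ->.
(* Adjoining [p] with coefficient 0 keeps the representation isometric, and its coefficient must
   equal [fock_adj p g]. *)
pose G q := if q == p then 0 else F q.
have GE q : q \in s -> G q = F q.
  by rewrite /G; case: eqP => // -> ps'; rewrite ps' in ps.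
have G0 : G p = 0 by rewrite /G eqxx.
rewrite -(@isometric_coef_adj Phi (p :: s) G g p cPhi) ?mem_head //=.
- by rewrite ps.
- by move=> q; rewrite inE => /orP[/eqP->//|]; apply: sPhi.
- rewrite big_cons G0 mul0r add0r gE big_seq [RHS]big_seq.
  by apply: eq_bigr => q /GE ->.
rewrite big_cons G0 fock_dot0l add0r nE big_seq [RHS]big_seq.
by apply: eq_bigr => q /GE ->.
Qed.

Definition enum_layer Phi n (s : seq A) : Prop :=
  uniq s /\ forall p, p \in s <-> Phi p /\ deg p = n.

Lemma enum_layer_free Phi n s (c : 'I_(size s) -> C) : lin_independent Phi ->
  enum_layer Phi n s -> \sum_i c i *: s`_i = 0 -> forall i, c i = 0.
Proof.
move=> liPhi [us sP]; apply: (liPhi (size s) (fun i => s`_i)).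
  by move=> i j /eqP; rewrite nth_uniq // => /eqP /val_inj.
by move=> i; have [] := (sP s`_i).1 (mem_nth 0 (ltn_ord i)).
Qed.

(** Independent polynomials of degree at most [n] have independent coefficient vectors, so there are
    no more of them than monomials of degree at most [n]. *)
Lemma enum_layer_exists Phi n : lin_independent Phi ->
  exists s, enum_layer Phi n s.
Proof.
move=> liPhi; pose T : finType := 'X_{1..d < n.+1}.
apply: (@finite_enum _ _ #|T|) => s us sX.
pose M := \matrix_(i < size s, j < #|T|) (s`_i)@_(enum_val j : T).
suff /eqP <- : row_free M by apply: rank_leq_col.
apply: inj_row_free => v vM0; apply/rowP => i; rewrite mxE.
apply: (liPhi _ (fun i : 'I_(size s) => s`_i) _ _ (v 0)).
- by move=> i' j /eqP; rewrite nth_uniq // => /eqP /val_inj.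
- by move=> k; have [] := sX s`_k (mem_nth 0 (ltn_ord k)).
apply/mpolyP => m; rewrite mcoeff0 raddf_sum /=.
have [mn|nm] := ltnP (mdeg m) n.+1.
  have := congr1 (fun B : 'rV_#|T| => B 0 (enum_rank (BMultinom mn))) vM0.
  rewrite !mxE => vM0m; rewrite -[RHS]vM0m; apply: eq_bigr => k _.
  by rewrite mcoeffZ mxE enum_rankK.
(* Here [mdeg m > n], while [deg = n] gives [msize <= n.+1]. *)
apply: big1 => k _; rewrite mcoeffZ memN_msupp_eq0 ?mulr0 //.
apply: msize_mdeg_ge; apply: leq_trans nm.
have [_] := sX s`_k (mem_nth 0 (ltn_ord k)).
by rewrite /deg => <-; apply: leqSpred.
Qed.

Lemma layer_homog I Phi n p : is_metric_basis I Phi -> Phi p -> deg p = n ->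
  p \is n.-homog.
Proof.
move=> [[hPhi _ _] _ _] /hPhi[_ [k /dhomog_msize]] /[swap].
by rewrite /deg => ->.
Qed.

Lemma layer_decomposition I Phi (e : nat -> seq A) n g :
  is_metric_basis I Phi -> (forall k, enum_layer Phi k (e k)) ->
  I g -> g \is n.-homog ->
  g = \sum_(k < n.+1) \sum_(p <- e k) fock_adj p g * p.
Proof.
move=> mPhi eP Ig hg.
have [s [us sPhi gE s0]] := metric_basis_adj mPhi Ig; rewrite [LHS]gE.
(* The terms are sorted by degree; those of degree above [n] have zero adjoint. *)
transitivity (\sum_(p <- s) \sum_(k < n.+1)
    (if deg p == k then fock_adj p g * p else 0)).
  apply: eq_big_seq => p ps.
  have hp := layer_homog mPhi (sPhi p ps) erefl.
  have [pn|np] := ltnP (deg p) n.+1; last first.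
    by rewrite (fock_adj_homog_gt hp hg np) mul0r big1 // => k _; case: ifP.
  rewrite (bigD1 (Ordinal pn)) //= eqxx big1 ?addr0 // => k.
  by rewrite -val_eqE /= eq_sym => /negbTE ->.
rewrite exchange_big; apply: eq_bigr => k _.
rewrite -big_mkcond -big_filter; have [ue ePk] := eP k.
(* The list [s] may miss elements of the layer, but their adjoints vanish on [g]. *)
apply: eq_big_nonzero => // [|p|p].
- by rewrite filter_uniq.
- by rewrite mem_filter => /andP[/eqP pk /sPhi Phip] _; apply/ePk.
move=> /ePk[Phip pk] Tp; rewrite mem_filter pk eqxx /=.
by apply/negPn/negP => ps; rewrite s0 ?mul0r ?eqxx in Tp.
Qed.
End MetricBases.

(** * Unitary matrices between layers of equal degree *)

Section UnitaryEquivalence.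
Local Open Scope ring_scope.
Local Open Scope sesquilinear_scope.
Variables (R : realType) (d : nat).
Notation C := R[i].
Notation A := {mpoly C[d]}.
Implicit Types (p q g : A) (I Phi Psi W : set A).

Definition free_family n (xi : 'I_n -> A) : Prop :=
  forall c : 'I_n -> C, \sum_i c i *: xi i = 0 -> forall i, c i = 0.

(** The inverse of the Gram matrix serves as [c]. A null row vector of the Gram matrix gives a
    combination of the [xi] orthogonal to itself, hence zero. *)
Lemma dual_family n (xi : 'I_n -> A) : free_family xi ->
  exists c : 'M[C]_n, forall l i,
    fock_dot (\sum_j c l j *: xi j) (xi i) = (l == i)%:R.
Proof.
move=> fxi; pose G := \matrix_(j, i) fock_dot (xi j) (xi i).
have dotE (v : 'I_n -> C) i :
    fock_dot (\sum_j v j *: xi j) (xi i) = \sum_j v j * G j i.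
  by rewrite fock_dot_suml; apply: eq_bigr => j _; rewrite fock_dotZl mxE.
have Gu : G \in unitmx.
  rewrite -row_free_unit; apply: inj_row_free => v vG0.
  apply/rowP => i; rewrite mxE; apply: (fxi (v 0)); apply: fock_dot_eq0.
  rewrite fock_dot_sumr big1 // => k _; rewrite fock_dotZr dotE.
  have := congr1 (fun B : 'rV_n => B 0 k) vG0.
  by rewrite !mxE => vG0k; rewrite [X in _ * X]vG0k mulr0.
exists (invmx G) => l i; rewrite dotE.
have := congr1 (fun B : 'M_n => B l i) (mulVmx Gu).
by rewrite !mxE => H; rewrite -[RHS]H.
Qed.

Lemma frame_isometry W n m (xi : 'I_n -> A) (eta : 'I_m -> A) :
  free_family xi -> free_family eta ->
  (forall k (v : 'I_k -> A) (c : 'I_k -> C), (forall i, W (v i)) ->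
     W (\sum_i c i *: v i)) ->
  (forall i, W (xi i)) -> (forall i, W (eta i)) ->
  (forall g, W g ->
     \sum_i fock_dot g (xi i) *: xi i = \sum_i fock_dot g (eta i) *: eta i) ->
  exists u : 'M[C]_(m, n),
    (forall i, eta i = \sum_j u i j *: xi j) /\ u^t* *m u = 1%:M.
Proof.
move=> fxi feta Wlin Wxi Weta WE.
have [c cP] := dual_family fxi; have [b bP] := dual_family feta.
pose u := \matrix_(i < m, j < n) fock_dot (\sum_k b i k *: eta k) (xi j).
have uE i : eta i = \sum_j u i j *: xi j.
  under eq_bigr do rewrite mxE.
  (* Applied to the [i]-th dual vector of [eta], the right side of [WE] is [eta i] and the left its
     expansion in [xi]. *)
  rewrite WE; last exact: Wlin.
  rewrite (bigD1 i) //= bP eqxx scale1r big1 ?addr0 // => j ij.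
  by rewrite bP eq_sym (negbTE ij) scale0r.
exists u; split=> //; apply/matrixP => l j; rewrite mxE [RHS]mxE.
apply/eqP; rewrite -subr_eq0; apply/eqP; move: j.
(* Freeness of [xi] reduces row [l] of the matrix identity to an expansion of [xi l], obtained from
   [WE] at the [l]-th dual vector of [xi]. *)
apply: fxi.
under eq_bigr do rewrite scalerBl.
rewrite sumrB; apply/eqP; rewrite subr_eq0; apply/eqP.
have -> : \sum_i (l == i)%:R *: xi i
        = \sum_i fock_dot (\sum_j c l j *: xi j) (xi i) *: xi i.
  by apply: eq_bigr => i _; rewrite cP.
rewrite WE; last exact: Wlin.
under eq_bigr do rewrite scaler_suml.
rewrite exchange_big; apply: eq_bigr => k _ /=.
have -> : fock_dot (\sum_j c l j *: xi j) (eta k) = (u k l)^*.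
  rewrite {1}uE fock_dot_sumr (bigD1 l) //= fock_dotZr cP eqxx mulr1.
  rewrite big1 ?addr0 // => j jl.
  by rewrite fock_dotZr cP eq_sym (negbTE jl) mulr0.
rewrite [X in _ *: X]uE scaler_sumr; apply: eq_bigr => j _.
by rewrite scalerA !mxE.
Qed.

(** The adjoint is conjugate-linear in the multiplier, so the coefficients combine to the entries of
    [u^t* *m u = 1%:M]. *)
Lemma unitary_layer n (xi eta : 'I_n -> A) (u : 'M[C]_n) g :
  u \is unitarymx -> (forall i, eta i = \sum_j u i j *: xi j) ->
  \sum_i fock_adj (eta i) g * eta i = \sum_i fock_adj (xi i) g * xi i.
Proof.
move=> /unitarymxP /mulmx1C uu etaE.
transitivity (\sum_l \sum_j \sum_i ((u i l)^* * u i j) *: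
    (fock_adj (xi l) g * xi j)).
  rewrite [RHS](eq_bigr (fun l => \sum_i \sum_j ((u i l)^* * u i j) *:
    (fock_adj (xi l) g * xi j))) => [|l _]; last by rewrite exchange_big.
  rewrite [RHS]exchange_big; apply: eq_bigr => i _ /=.
  rewrite etaE fock_adj_sum mulr_suml; apply: eq_bigr => l _.
  rewrite mulr_sumr; apply: eq_bigr => j _.
  by rewrite -scalerAl -scalerAr scalerA.
have uuE l j : \sum_i (u i l)^* * u i j = (l == j)%:R.
  have := congr1 (fun B : 'M_n => B l j) uu.
  by rewrite !mxE => H; rewrite -[RHS]H; apply: eq_bigr => i _; rewrite !mxE.
apply: eq_bigr => l _.
under eq_bigr do rewrite -scaler_suml uuE.
rewrite (bigD1 l) //= eqxx scale1r big1 ?addr0 // => j jl.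
by rewrite eq_sym (negbTE jl) scale0r.
Qed.

Lemma enumerates_sum (X : set A) n (v : 'I_n -> A) (s : seq A) (F : A -> A) :
  enumerates v X -> uniq s -> (forall p, p \in s <-> X p) ->
  \sum_(p <- s) F p = \sum_i F (v i).
Proof.
move=> [vI vX] us sX; rewrite -big_enum -(big_map v xpredT F).
apply/perm_big/uniq_perm => //; first by rewrite map_inj_uniq ?enum_uniq.
move=> p; apply/idP/mapP => [/sX|[i _ ->]].
  by rewrite -vX => -[i _ <-]; exists i; rewrite ?mem_enum.
by apply/sX; rewrite -vX; exists i.
Qed.

Lemma seq_enumerates (X : set A) (s : seq A) :
  uniq s -> (forall p, p \in s <-> X p) ->
  enumerates (fun i : 'I_(size s) => s`_i) X.
Proof.
move=> us sX; split.
  by move=> i j /eqP; rewrite nth_uniq // => /eqP /val_inj.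
apply/seteqP; split=> [p [i _ <-]|p /sX ps].
  by apply/sX; rewrite mem_nth.
have ip : (index p s < size s)%N by rewrite index_mem.
by exists (Ordinal ip) => //=; rewrite nth_index.
Qed.

Lemma unitary_equivalent_fin (X Y : set A) m n (xi : 'I_n -> A)
    (eta : 'I_m -> A) (u : 'M[C]_(m, n)) : m = n ->
  enumerates xi X -> enumerates eta Y -> u^t* *m u = 1%:M ->
  (forall i, eta i = \sum_j u i j *: xi j) -> equivalent_fin X Y.
Proof.
(* Once [u] is square, its left inverse is also a right inverse. *)
move=> mn; case: _ / mn in xi u *; move=> xiP etaP uu etaE.
exists m, xi, eta; split=> //; exists u; first exact/unitarymxP/mulmx1C.
by move=> i; rewrite etaE.
Qed.

Lemma equivalent_layer_sum Phi Psi n s t g :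
  equivalent_fin [set p | Phi p /\ deg p = n] [set p | Psi p /\ deg p = n] ->
  enum_layer Phi n s -> enum_layer Psi n t ->
  \sum_(p <- s) fock_adj p g * p = \sum_(p <- t) fock_adj p g * p.
Proof.
move=> [k [xi [eta [xiP etaP [u uu etaE]]]]] [us sP] [ut tP].
rewrite (enumerates_sum (fun p => fock_adj p g * p) xiP us sP).
rewrite (enumerates_sum (fun p => fock_adj p g * p) etaP ut tP).
by rewrite (unitary_layer g uu etaE).
Qed.

Lemma metric_bases_equivalent I Phi Psi : is_ideal I ->
  is_metric_basis I Phi -> is_metric_basis I Psi -> equivalent_sets Phi Psi.
Proof.
move=> [I0 ID IM] mPhi mPsi.
have liPhi : lin_independent Phi by case: mPhi => -[].
have liPsi : lin_independent Psi by case: mPsi => -[].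
have [e eP] := choice (fun n => enum_layer_exists n liPhi).
have [f fP] := choice (fun n => enum_layer_exists n liPsi).
elim/ltn_ind => n IHn.
have homE Xi (s : seq A) p g : is_metric_basis I Xi -> enum_layer Xi n s ->
    g \is n.-homog -> p \in s -> fock_adj p g * p = fock_dot g p *: p.
  move=> mXi [_ sP] hg /sP[Xip pn].
  by rewrite (fock_adj_homog_eq (layer_homog mXi Xip pn) hg) mul_mpolyC.
have topE g : I g -> g \is n.-homog ->
    \sum_(i < size (e n)) fock_dot g (e n)`_i *: (e n)`_i
  = \sum_(i < size (f n)) fock_dot g (f n)`_i *: (f n)`_i.
  move=> Ig hg.
  have := layer_decomposition mPsi fP Ig hg.
  (* Layers below [n] agree by induction and cancel; layer [n] remains. *)
  rewrite {1}(layer_decomposition mPhi eP Ig hg) !big_ord_recr /=.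
  rewrite (eq_bigr (fun k : 'I_n =>
    \sum_(p <- f k) fock_adj p g * p)) => [|k _].
    move/addrI; rewrite (eq_big_seq _ (fun p => homE _ _ p g mPhi (eP n) hg)).
    rewrite (eq_big_seq _ (fun p => homE _ _ p g mPsi (fP n) hg)).
    by rewrite (big_nth 0) big_mkord [RHS](big_nth 0) big_mkord.
  exact: equivalent_layer_sum (IHn k (ltn_ord k)) (eP k) (fP k).
pose W : set A := fun g => I g /\ g \is n.-homog.
have Wlin k (v : 'I_k -> A) (c : 'I_k -> C) : (forall i, W (v i)) ->
    W (\sum_i c i *: v i).
  move=> Wv; split; last by apply: rpred_sum => i _; apply/rpredZ/(Wv i).2.
  by apply: big_ind => // i _; rewrite -mul_mpolyC; apply/IM/(Wv i).1.
have Wlayer Xi (s : seq A) : is_metric_basis I Xi -> enum_layer Xi n s ->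
    forall i : 'I_(size s), W s`_i.
  move=> mXi [_ sP] i; have [Xii degi] := (sP s`_i).1 (mem_nth 0 (ltn_ord i)).
  split; last exact: layer_homog mXi Xii degi.
  by case: mXi => -[/(_ _ Xii)[]].
have fe : free_family (fun i : 'I_(size (e n)) => (e n)`_i).
  by move=> c; apply: enum_layer_free liPhi (eP n).
have ff : free_family (fun i : 'I_(size (f n)) => (f n)`_i).
  by move=> c; apply: enum_layer_free liPsi (fP n).
have We := Wlayer _ _ mPhi (eP n); have Wf := Wlayer _ _ mPsi (fP n).
have [u [uE uu]] :=
  frame_isometry fe ff Wlin We Wf (fun g Wg => topE g Wg.1 Wg.2).
have [v [_ vv]] :=
  frame_isometry ff fe Wlin Wf We (fun g Wg => esym (topE g Wg.1 Wg.2)).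
(* Isometries in both directions force the two layers to have equal size, by rank. *)
have isometry_leq (a b : nat) (w : 'M[C]_(a, b)) :
    w^t* *m w = 1%:M -> (b <= a)%N.
  move=> ww; rewrite -(mxrank1 C b) -ww.
  by rewrite (leq_trans (mxrankM_maxr _ _)) ?rank_leq_row.
have size_ef : size (f n) = size (e n).
  by apply/eqP; rewrite eqn_leq (isometry_leq _ _ _ uu) (isometry_leq _ _ _ vv).
exact: (unitary_equivalent_fin size_ef (seq_enumerates (eP n).1 (eP n).2)
  (seq_enumerates (fP n).1 (fP n).2) uu uE).
Qed.

End UnitaryEquivalence.

Theorem corollary1 (R : realType) (d : nat) (d_ge1 : (1 <= d)%N)
    (I Phi Psi : set {mpoly R[i][d]}) :
  is_ideal I -> graded I -> (exists g, I g /\ g <> 0%R) ->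
  is_metric_basis I Phi -> is_metric_basis I Psi ->
  equivalent_sets Phi Psi.
Proof. by move=> idI _ _; apply: metric_bases_equivalent. Qed.
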